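(* For every integer $s$ with $2\le s\le 78$, the $s$-node Clenshaw-Curtis collocation method is A-stable.
   Context: For distinct nodes $c_1,\dots,c_s\in[0,1]$, the collocation method is the Runge-Kutta method $$y_{n+1}=y_n+h\sum_{j=1}^s b_j f(t_n+c_jh,Y_j),\qquad Y_i=y_n+h\sum_{j=1}^s a_{ij}f(t_n+c_jh,Y_j)\quad (i=1,\dots,s)$$ with coefficients $$a_{ij}=\int_0^{c_i} l_j(t)\,dt,\qquad b_j=\int_0^1 l_j(t)\,dt,\qquad l_j(t)=\prod_{k\ne j}\frac{t-c_k}{c_j-c_k}.$$ The $s$-node Clenshaw-Curtis collocation method ($s\ge2$) is the collocation method with nodes $c_i=\frac12\left(1-\cos\frac{(i-1)\pi}{s-1}\right)$, $i=1,\dots,s$. The stability function of a Runge-Kutta method with matrix $A=(a_{ij})$ and weight vector $b=(b_1,\dots,b_s)^T$ is the rational function $r(z)=1+z\,b^T(I-zA)^{-1}\mathbf 1$, where $\mathbf 1=(1,\dots,1)^T$. The method is called A-stable if $|r(z)|<1$ for all $z\in\mathbb C$ with $\operatorname{Re}(z)<0$. *)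

(* Defs.v *)
From mathcomp Require Import all_boot all_order all_algebra.
From mathcomp Require Import fraction complex.
From mathcomp Require Import all_classical all_reals all_analysis.

Set Implicit Arguments.
Unset Strict Implicit.
Unset Printing Implicit Defensive.

Import Order.TTheory GRing.Theory Num.Theory.

Local Open Scope classical_set_scope.
Local Open Scope ring_scope.
Local Open Scope complex_scope.

Section RungeKutta.
Context (R : realType).

Record runge_kutta (s : nat) := RungeKutta {
  rk_A : 'M[R]_s;
  rk_b : 'cV[R]_s;
  rk_c : 'cV[R]_s }.

Definition lagrange_basis s (c : 'I_s -> R) (j : 'I_s) (t : R) : R :=
  \prod_(k < s | k != j) ((t - c k) / (c j - c k)).

(* The nodes [c] are meant to be pairwise distinct and to lie in [0, 1]; the
   integral over the set [0, c i] is then the oriented integral from 0 to c i. *)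
Definition collocation s (c : 'I_s -> R) : runge_kutta s :=
  RungeKutta
    (\matrix_(i, j) \int[lebesgue_measure]_(t in `[0, c i]) lagrange_basis c j t)
    (\col_j \int[lebesgue_measure]_(t in `[0, 1]) lagrange_basis c j t)
    (\col_i c i).

(* Indices start at 0 here: [i : 'I_s] is the node usually numbered [i + 1]. *)
Definition clenshaw_curtis_node s (i : 'I_s) : R :=
  2^-1 * (1 - cos (i%:R * pi / s.-1%:R)).

Definition clenshaw_curtis_collocation s : runge_kutta s :=
  collocation (@clenshaw_curtis_node s).

Definition ratfun := {fraction {poly R[i]}}.

Definition ratfun_const (a : R) : ratfun := tofrac (a%:C)%:P.

Definition ratfun_X : ratfun := tofrac 'X.

(* The matrix I - zA is inverted over the field of rational functions in z,
   where it is always invertible since its determinant is 1 at z = 0. *)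
Definition stability_function s (m : runge_kutta s) : ratfun :=
  1 + ratfun_X *
    ((map_mx ratfun_const (rk_b m))^T
       *m invmx (1%:M - ratfun_X *: map_mx ratfun_const (rk_A m))
       *m (const_mx 1 : 'cV_s)) 0 0.

(* [ratfun_value r z w]: the rational function r has no pole at z, and its
   value there is w. *)
Definition ratfun_value (r : ratfun) (z w : R[i]) : Prop :=
  exists p q : {poly R[i]},
    [/\ q.[z] != 0, r = tofrac p / tofrac q & w = p.[z] / q.[z]].

Lemma ratfun_value_unique (r : ratfun) (z w w' : R[i]) :
  ratfun_value r z w -> ratfun_value r z w' -> w = w'.
Proof.
have nz (q : {poly R[i]}) : q.[z] != 0 -> tofrac q != 0.
  by move=> qz; rewrite tofrac_eq0; apply: contraNneq qz => ->; rewrite horner0.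
move=> [p [q [qz -> ->]]] [p' [q' [q'z /eqP]]].
rewrite eqr_div ?nz // -!tofracM tofrac_eq => /eqP e ->.
by apply/eqP; rewrite eqr_div // -!hornerM e.
Qed.

Definition A_stable s (m : runge_kutta s) : Prop :=
  forall z : R[i], complex.Re z < 0 ->
    exists2 w : R[i], ratfun_value (stability_function m) z w & `|w| < 1.

End RungeKutta.

(* Main.v *)
Require Import Defs.
From HB Require Import structures.
From mathcomp Require Import all_boot all_order all_algebra.
From mathcomp Require Import fraction complex.
From mathcomp Require Import all_classical all_reals all_analysis.
From mathcomp Require Import ring lra zify.

(** The heart of the proof is an energy estimate for a polynomial differential
    equation whose right-hand side vanishes at all nodes.

    Let there be n + 2 nodes and put N = n + 1.  In the variable x = 1 - 2t the
    nodes are the extrema x_i = cos (i pi / N) of the Chebyshev polynomial T_N.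
    For fixed z, stage values Y_i = a + z sum_j a_ij Y_j are the values at the
    nodes of a polynomial P of degree at most n + 2 with P (0) = a, with
    P (1) = a + z sum_j b_j Y_j, and with P' - z P zero at every node.  After the
    substitution Y (x) = P ((1 - x) / 2), the polynomial Y - mu Y', where
    mu = -2 / z, is a multiple of W = prod_i (X - x_i).  So both claims, that
    I - z A is invertible (a = 0) and that the stability function is below 1 in
    modulus (a = 1), follow from |Y (-1)| < |Y (1)| for Re mu > 0
    [collocation_ends].

    Up to a scalar, Y is sum_k mu ^ k W^(k) [resolvent].  Its value at 1 is
    mu p (mu), where p has the real coefficients W^(k+1) (1), and by the parity
    of W its value at -1 is mu p (- mu) up to sign.  If every root of p has
    negative real part, comparing the linear factors of p gives
    |p (- mu)| < |p (mu)| [hurwitz_reflection].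

    For a root mu of p, which is nonzero because p (0) = W' (1), the equation
    u - mu u' = W has a solution u with u (1) = 0; then also u' (1) = 0, because
    W (1) = 0.  The claim Re mu < 0 is [energy_estimate].  Write
    u = (x - 1)^2 v and u' = (x - 1) g, multiply the equation by
    (1 + x) conj g, and sum over the 2 N equispaced angles.  The right-hand side
    vanishes, for W is zero at all these points.  The sum integrates against the
    weight (1 - x^2)^(-1/2), exactly up to degree 2 N - 1, and so satisfies a
    formula of integration by parts with a defect at the coefficient of degree
    2 N - 1 [extremum_sum_parts].  Twice the real part of the first term becomes
    the sum of (x - 1)^2 (2 + x) |v|^2, which is nonnegative, plus a positive
    multiple of 2 + 2 (n + 2) Re mu.  The second term is mu times the sum of
    (1 - x^2) |g|^2, which is nonnegative.  Since the two terms cancel, a positive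
    multiple of Re mu is negative. *)

Set Implicit Arguments.
Unset Strict Implicit.
Unset Printing Implicit Defensive.

Import Order.TTheory GRing.Theory Num.Theory.
Import numFieldNormedType.Exports.

Local Open Scope ring_scope.

Local Notation conjp := (map_poly Num.conj).
Local Notation toC := (real_complex _).

(** * Polynomials *)

Lemma horner_conjp (C : numClosedFieldType) (p : {poly C}) (x : C) :
  x \is Num.real -> (conjp p).[x] = p.[x]^*.
Proof. by move=> /CrealP xr; rewrite -{1}xr horner_map. Qed.

(** Only two terms of the convolution reach the coefficient just below the top
    one.  With a bound that is one too large this also gives the top one. *)
Lemma coefM_top (A : comNzRingType) (p q : {poly A}) (m n : nat) :
    (size p <= m.+2)%N -> (size q <= n.+2)%N ->
  (p * q)`_(m + n).+1 = p`_m.+1 * q`_n + p`_m * q`_n.+1.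
Proof.
move=> sp sq.
have small d i (r : {poly A}) : (size r <= d.+2)%N -> (d.+2 <= i)%N -> r`_i = 0.
  by move=> sr di; rewrite nth_default //; exact: leq_trans di.
have mo : (m.+1 < (m + n).+2)%N by rewrite !ltnS leq_addr.
rewrite coefM (bigD1 (Ordinal mo)) //=.
have -> : ((m + n).+1 - m.+1 = n)%N by rewrite subSS addKn.
congr (_ + _).
rewrite (bigD1 (Ordinal (ltnW mo))) /=; last first.
  by rewrite -val_eqE /= neq_ltn ltnSn.
have -> : ((m + n).+1 - m = n.+1)%N by rewrite -addnS addKn.
rewrite big1 ?addr0 // => i; rewrite -!val_eqE /= => /andP[i1 i2].
have [ilt|igt] : (n.+2 <= (m + n).+1 - i)%N \/ (m.+2 <= i)%N by lia.
- by rewrite [X in _ * X](small n) ?mulr0.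
- by rewrite (small m) ?mul0r.
Qed.

Definition node_sum (A : comNzRingType) (m : nat) (x : 'I_m -> A)
  (p : {poly A}) : A := \sum_(j < m) p.[x j].

Fact node_sum_is_scalar (A : comNzRingType) (m : nat) (x : 'I_m -> A) :
  scalar (node_sum x).
Proof.
move=> a p q; rewrite /node_sum mulr_sumr -big_split /=.
by apply: eq_bigr => j _; rewrite hornerD hornerZ.
Qed.

HB.instance Definition _ (A : comNzRingType) (m : nat) (x : 'I_m -> A) :=
  GRing.isLinear.Build A {poly A} A _ (node_sum x) (node_sum_is_scalar x).

(** * Chebyshev polynomials *)

Section Chebyshev.
Variable A : comNzRingType.

Fixpoint chebyshev (k : nat) : {poly A} :=
  match k with
  | 0 => 1
  | k1.+1 =>
    match k1 with
    | 0 => 'X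
    | k2.+1 => 'X *+ 2 * chebyshev k1 - chebyshev k2
    end
  end.

Lemma chebyshevSS k : chebyshev k.+2 = 'X *+ 2 * chebyshev k.+1 - chebyshev k.
Proof. by []. Qed.

Lemma size_chebyshev k : (size (chebyshev k) <= k.+1)%N.
Proof.
elim/ltn_ind: k => [[|[|k]]] IH; rewrite ?size_polyC ?size_polyX ?leq_b1 //.
have szX : (size ('X *+ 2 * chebyshev k.+1)%R <= k.+3)%N.
  rewrite mulrnAl -scaler_nat (leq_trans (size_scale_leq _ _)) //.
  rewrite (leq_trans (size_polyMleq _ _)) // size_polyX.
  exact: IH k.+1 (ltnSn _).
rewrite chebyshevSS (leq_trans (size_polyD _ _)) // size_polyN geq_max szX /=.
by rewrite (leq_trans (IH k _)) // leqW.
Qed.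

Lemma coef_chebyshev k :
  (chebyshev k.+1)`_k.+1 = 2 ^+ k /\ (chebyshev k.+1)`_k = 0.
Proof.
elim: k => [|k [lead next]]; first by rewrite coefX /= expr0 coefX.
rewrite chebyshevSS !coefB !mulrnAl !coefMn !coefXM /= lead.
rewrite exprS mulr_natl (nth_default _ (size_chebyshev k)).
split; first by rewrite (nth_default _ (leqW (size_chebyshev k))) subr0.
by rewrite next mul0rn subr0.
Qed.

(** For X = cos a both sides are minus twice the derivative of
    sin a * cos ((k + 1) a) with respect to a. *)
Lemma chebyshev_deriv k :
  ((1 - 'X^2) * (chebyshev k.+1)^`() - 'X * chebyshev k.+1) *+ 2
  = chebyshev k *+ k - chebyshev k.+2 *+ k.+2.
Proof.
elim/ltn_ind: k => [[|[|k]]] IH.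
- rewrite chebyshevSS /= derivX mulr0n; ring.
- rewrite !chebyshevSS /= derivB derivM derivMn derivX derivC; ring.
have e0 := IH k (leqnSn _); have e1 := IH k.+1 (ltnSn _).
have tk : chebyshev k = 'X *+ 2 * chebyshev k.+1 - chebyshev k.+2.
  by rewrite chebyshevSS opprB addrC subrK.
rewrite tk in e0; rewrite [chebyshev k.+3]chebyshevSS in e1.
rewrite [chebyshev k.+4]chebyshevSS [chebyshev k.+3]chebyshevSS.
rewrite derivB derivM derivMn derivX.
move: e0 e1; move: (chebyshev k.+1)^`() (chebyshev k.+2)^`() => a' b'.
move: (chebyshev k.+1) (chebyshev k.+2) => a b e0 e1.
apply/eqP; rewrite -subr_eq0; apply/eqP.
(* The claim for k + 2 is 2 X times the claim for k + 1 minus the claim for k. *)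
transitivity ('X *+ 2 * (((1 - 'X^2) * b' - 'X * b) *+ 2
                         - (a *+ k.+1 - ('X *+ 2 * b - a) *+ k.+3))
              - (((1 - 'X^2) * a' - 'X * a) *+ 2
                 - (('X *+ 2 * a - b) *+ k - b *+ k.+2))).
  ring.
by rewrite e0 e1 !subrr mulr0 subrr.
Qed.
End Chebyshev.

Lemma chebyshev_span (F : numFieldType) (P : {poly F} -> Prop) d :
    (forall p q, P p -> P q -> P (p + q)) -> (forall a p, P p -> P (a *: p)) ->
  (forall k, (k <= d)%N -> P (chebyshev F k)) ->
  forall p : {poly F}, (size p <= d.+1)%N -> P p.
Proof.
move=> PD PZ; elim: d => [|d IH] PT p sp.
  rewrite (size1_polyC sp) -alg_polyC; apply: PZ.
  exact: (PT 0%N).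
have t0 : (chebyshev F d.+1)`_d.+1 != 0.
  by rewrite (coef_chebyshev F d).1 expf_neq0 // pnatr_eq0.
pose c := p`_d.+1 / (chebyshev F d.+1)`_d.+1.
rewrite -(subrK (c *: chebyshev F d.+1) p); apply: (PD); last exact/PZ/PT.
apply: IH => [k kd|]; first by apply: PT; exact: leqW.
apply/leq_sizeP => j; rewrite leq_eqVlt coefB coefZ => /orP[/eqP <-|lt_j].
  by rewrite divfK ?subrr.
rewrite !nth_default ?mulr0 ?subr0 //.
  exact: leq_trans (size_chebyshev _ _) _.
exact: leq_trans sp _.
Qed.

Lemma map_chebyshev (A B : comNzRingType) (f : {rmorphism A -> B}) k :
  map_poly f (chebyshev A k) = chebyshev B k.
Proof.
elim/ltn_ind: k => [[|[|k]]] IH; rewrite ?rmorph1 ?map_polyX //.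
rewrite !chebyshevSS rmorphB rmorphM rmorphMn /= map_polyX.
by rewrite (IH k.+1 (ltnSn _)) (IH k (leqnSn _)).
Qed.

Lemma chebyshev_cos (R : realType) k (a : R) :
  (chebyshev R k).[cos a] = cos (k%:R * a).
Proof.
elim/ltn_ind: k => [[|[|k]]] IH; first by rewrite hornerC mul0r cos0.
  by rewrite hornerX mul1r.
rewrite chebyshevSS !hornerE IH // IH //.
have -> : k.+2%:R * a = k.+1%:R * a + a by rewrite -[k.+2]addn1 natrD mulrDl mul1r.
have -> : k%:R * a = k.+1%:R * a - a by rewrite -[k.+1]addn1 natrD mulrDl mul1r addrK.
rewrite cosB cosD; ring.
Qed.

(** Multiplying by sin (a / 2) makes the sum telescope, and 2 pi m closes it. *)
Lemma sum_cos_eq0 (R : realType) (N m : nat) (a : R) :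
  sin (a / 2) != 0 -> N%:R * a = pi *+ 2 *+ m ->
  \sum_(j < N) cos (j%:R * a) = 0.
Proof.
move=> sa Na; apply: (mulfI sa); rewrite mulr0 mulr_sumr.
rewrite -(big_mkord xpredT (fun j => sin (a / 2) * cos (j%:R * a))).
pose f j := sin (j%:R * a - a / 2) / 2.
rewrite (@telescope_sumr_eq _ 0 N f) // => [|j _]; last first.
  have e : j.+1%:R * a - a / 2 = j%:R * a + a / 2 by rewrite -natr1; field.
  by rewrite /f e sinD sinB; field.
rewrite /f Na mul0r sub0r [pi *+ 2 *+ m - _]addrC.
by rewrite (periodicn (@sinD2pi R)) subrr.
Qed.

(** * Summation over the Chebyshev extrema *)

Section Extrema.
Variables (R : realType) (n : nat).
Local Notation N := n.+1.
Local Notation C := R[i].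

Definition extremum (j : nat) : R := cos (j%:R * (pi / N%:R)).

(** The angles run over a full turn: every interior extremum occurs twice and the
    end points 1 and -1 once, which are the weights that make the sum a
    quadrature rule for the Chebyshev weight. *)
Local Notation extremum_sum := (node_sum (fun j : 'I_N.*2 => toC (extremum j))).

Lemma sum_chebyshev k :
  extremum_sum (chebyshev C k) =
  toC (\sum_(j < N.*2) cos (j%:R * (k%:R * (pi / N%:R)))).
Proof.
rewrite /node_sum rmorph_sum; apply: eq_bigr => j _ /=.
rewrite mulrCA -chebyshev_cos -/(extremum j).
rewrite -(horner_map (real_complex R)); congr horner.
by rewrite map_chebyshev.
Qed.

Lemma sum_chebyshev_eq0 k : (0 < k <= N.*2.+1)%N -> k != N.*2 ->
  extremum_sum (chebyshev C k) = 0.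
Proof.
move=> /andP[k0 kN] kN2; rewrite sum_chebyshev (@sum_cos_eq0 _ _ k) //.
  have pi0 := pi_gt0 R.
  have sin_gt0 (i : nat) : (0 < i < N.*2)%N -> 0 < sin (i%:R * (pi / N%:R) / 2) :> R.
    move=> /andP[i0 iN]; apply: sin_gt0_pi; rewrite mulrA -mulrA -invfM.
    rewrite divr_gt0 ?mulr_gt0 ?ltr0n // ltr_pdivrMr ?mulr_gt0 ?ltr0n // mulrC.
    by rewrite ltr_pM2l // -natrM ltr_nat muln2.
  move: kN; rewrite leq_eqVlt => /orP[/eqP ->|kN1].
    have -> : N.*2.+1%:R * (pi / N%:R) / 2 = 1%:R * (pi / N%:R) / 2 + pi :> R.
      by rewrite -natr1 -muln2 natrM; field.
    by rewrite sinDpi oppr_eq0 gt_eqF // sin_gt0 // -muln2; lia.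
  by rewrite gt_eqF // sin_gt0 // k0 ltn_neqAle kN2.
rewrite -muln2 natrM; field.
by rewrite nat1r pnatr_eq0.
Qed.

Lemma sum_chebyshev_full : extremum_sum (chebyshev C N.*2) = N.*2%:R.
Proof.
rewrite sum_chebyshev (eq_bigr (fun=> 1)) ?sumr_const ?card_ord ?rmorph_nat // => j _.
have -> : (j : nat)%:R * (N.*2%:R * (pi / N%:R)) = 0 + pi *+ 2 *+ j :> R.
  move: (j : nat) => i; rewrite -muln2 natrM; field.
  by rewrite nat1r pnatr_eq0.
by rewrite (periodicn (@cosD2pi R)) cos0.
Qed.

(** In terms of p (cos a) this is the vanishing of the mean of the derivative of
    sin a * p (cos a), a trigonometric polynomial of degree at most 2 N + 1; the
    sum sees the Fourier modes of order 2 N as constants, whence the last term.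
    It suffices to check p = T_k, and only T_(2 N - 1) contributes. *)
Lemma extremum_sum_parts (p : {poly C}) : (size p <= n.*2.+3)%N ->
  extremum_sum ((1 - 'X^2) * p^`()) =
  extremum_sum ('X * p) - (N ^ 2 * 2)%:R / 4 ^+ n * p`_n.*2.+1.
Proof.
move: p; apply: chebyshev_span.
- move=> p q Ep Eq; rewrite derivD !mulrDr !linearD /= Ep Eq.
  by rewrite coefD; ring.
- move=> a p Ep; rewrite derivZ -!scalerAr [LHS]linearZ [node_sum _ (a *: _)]linearZ /=.
  by rewrite Ep coefZ mulrBr mulrCA.
case=> [|k] kn.
  rewrite derivC mulr0 mulr1 linear0 coef1 mulr0 subr0.
  by rewrite [RHS](sum_chebyshev_eq0 (k := 1)).
have E : (extremum_sum ((1 - 'X^2) * (chebyshev C k.+1)^`())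
          - extremum_sum ('X * chebyshev C k.+1)) *+ 2 =
    extremum_sum (chebyshev C k) *+ k - extremum_sum (chebyshev C k.+2) *+ k.+2.
  by rewrite -linearB -linearMn chebyshev_deriv linearB !linearMn.
apply: (mulIf (x := 2)); first by rewrite pnatr_eq0.
have {E} -> : extremum_sum ((1 - 'X^2) * (chebyshev C k.+1)^`()) * 2 =
    extremum_sum ('X * chebyshev C k.+1) * 2 +
    (extremum_sum (chebyshev C k) *+ k - extremum_sum (chebyshev C k.+2) *+ k.+2).
  by rewrite -E; ring.
have -> : extremum_sum (chebyshev C k) *+ k = 0.
  case: (k) kn => [|i] kn; first by rewrite mulr0n.
  rewrite sum_chebyshev_eq0 ?mul0rn //; [lia|].
  by rewrite neq_ltn; lia.
have [-> | kn2] := eqVneq k n.*2.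
  (* T_(2 N - 1) has the leading coefficient 4 ^ n. *)
  rewrite sum_chebyshev_full (coef_chebyshev C n.*2).1.
  have -> : 2 ^+ n.*2 = 4 ^+ n :> C by rewrite -muln2 mulnC exprM -natrX.
  rewrite divfK ?expf_neq0 ?pnatr_eq0 // sub0r -[X in - X]mulr_natr -natrM mulrBl.
  rewrite -natrM.
  by congr (_ - _%:R); rewrite -doubleS; lia.
rewrite sum_chebyshev_eq0; [|lia|lia].
have -> : (chebyshev C k.+1)`_n.*2.+1 = 0.
  case: (ltngtP k n.*2) kn2 => // [lt|gt] _.
    by rewrite nth_default // (leq_trans (size_chebyshev _ _)).
  have -> : k = n.*2.+1 by lia.
  exact: (coef_chebyshev C _).2.
by rewrite mulr0 mul0rn !subr0 addr0.
Qed.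
End Extrema.

(** * Polynomials with all roots in the left half plane *)

Lemma ltr_norm_reflect (C : numClosedFieldType) (mu z : C) :
  0 < 'Re mu -> 'Re z < 0 -> `|- mu^* - z| < `|mu - z|.
Proof.
rewrite !ReE pmulr_lgt0 ?pmulr_llt0 ?invr_gt0 ?ltr0n // => mu_gt0 z_lt0.
rewrite -(@ltr_pXn2r _ 2) ?nnegrE // !normCK.
rewrite !rmorphB rmorphN /= conjCK -subr_gt0.
have -> : (mu - z) * (mu^* - z^*) - (- mu^* - z) * (- mu - z^*) =
          - ((mu + mu^*) * (z + z^*)) by ring.
by rewrite oppr_gt0 pmulr_rlt0.
Qed.

(** As p is real, |p (- mu)| = |p (- conj mu)|, and for each root z the point mu
    lies farther from z than its mirror image - conj mu in the imaginary axis. *)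
Lemma hurwitz_reflection (C : numClosedFieldType) (p : {poly C}) (mu : C) :
    conjp p = p -> (1 < size p)%N -> (forall z, root p z -> 'Re z < 0) ->
  0 < 'Re mu -> `|p.[- mu]| < `|p.[mu]|.
Proof.
move=> p_real p_size p_roots mu_gt0.
have [r pr] := closed_field_poly_normal p.
have p0 : p != 0 by rewrite -size_poly_gt0 ltnW.
have -> : `|p.[- mu]| = `|p.[- mu^*]|.
  by rewrite -norm_conjC -horner_map p_real rmorphN.
rewrite pr !hornerZ !normrM ltr_pM2l ?normr_gt0 ?lead_coef_eq0 //.
rewrite !horner_prod !normr_prod big_seq [ltRHS]big_seq.
apply: ltr_prod.
  apply/hasP; have : r != [::].
    apply: contraTneq p_size => r0.
    by rewrite pr r0 big_nil alg_polyC -leqNgt size_polyC_leq1.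
  by case: (r) => // z s _; exists z; rewrite mem_head.
move=> z zr; rewrite normr_ge0 !hornerXsubC /= ltr_norm_reflect // p_roots //.
by rewrite pr rootZ ?lead_coef_eq0 // root_prod_XsubC.
Qed.

(** * The equation u - mu u' = W *)

Section Resolvent.
Variable F : numFieldType.
Implicit Types (mu : F) (W u : {poly F}).

(** The Neumann series of the inverse of u |-> u - mu u', which is finite because
    differentiation is nilpotent on polynomials of bounded degree. *)
Definition resolvent mu W := \sum_(k < size W) mu ^+ k *: W^`(k).

Lemma resolventP mu W : resolvent mu W - mu *: (resolvent mu W)^`() = W.
Proof.
rewrite /resolvent raddf_sum /= scaler_sumr -sumrB.
rewrite -(big_mkord xpredT (fun k => mu ^+ k *: W^`(k) - mu *: (mu ^+ k *: W^`(k))^`())).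
rewrite (@telescope_sumr_eq _ 0 _ (fun k => - (mu ^+ k *: W^`(k)))) //.
  by rewrite opprK derivn_poly0 // scaler0 oppr0 add0r expr0 scale1r derivn0.
by move=> k _; rewrite opprK addrC derivZ scalerA -exprS -derivnS.
Qed.

Lemma resolvent_unique mu u : u - mu *: u^`() = 0 -> u = 0.
Proof.
move=> u0; apply/eqP/negPn/negP => un0.
have := lt_size_deriv un0; rewrite ltnNge => /negP[].
by move/eqP: u0; rewrite subr_eq0 => /eqP {1}->; exact: size_scale_leq.
Qed.

(** For W (x) = 0 the value has the factor mu, whose root 0 does not lie in the
    open left half plane; the cofactor is the polynomial to be shown stable. *)
Lemma horner_resolvent mu W x :
  (resolvent mu W).[x] = W.[x] + mu * (\poly_(k < (size W).-1) W^`(k.+1).[x]).[mu].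
Proof.
rewrite /resolvent horner_poly mulr_sumr.
case: (posnP (size W)) => [W0|/prednK <-].
  rewrite W0 !big_ord0 horner0 addr0; move/eqP: W0.
  by rewrite size_poly_eq0 => /eqP ->; rewrite horner0.
rewrite big_ord_recl hornerD expr0 scale1r derivn0 horner_sum; congr (_ + _).
by apply: eq_bigr => k _; rewrite hornerZ exprS -mulrA [W^`(_).[_] * _]mulrC.
Qed.

End Resolvent.

(** * The energy estimate *)

(** For real X, read vb as the conjugate of v, and dv, dvb as derivatives: with
    u = (X - 1)^2 v and g = 2 v + (X - 1) v', the left-hand side is
    (1 + X) (u conj g + conj u g), and on the right the bracket is the derivative
    of p = (X - 1)^2 |v|^2.  This form isolates (1 - X^2) p', to which
    integration by parts applies. *)
Fact energy_identity (A : comNzRingType) (X v vb dv dvb : A) :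
  v * (X - 1) ^+ 2 * ((1 + X) * (vb *+ 2 + (X - 1) * dvb)) +
  vb * ((X - 1) * (X - 1)) * ((1 + X) * (v *+ 2 + (X - 1) * dv)) =
  - ((1 - X ^+ 2) *
   (((X - 1) + (X - 1)) * (v * vb) +
    (X - 1) ^+ 2 * (dv * vb + v * dvb))) +
  2 * (1 + X) * ((X - 1) ^+ 2 * (v * vb)).
Proof. ring. Qed.

Section Energy.
Variables (C : numClosedFieldType) (n m : nat) (x : 'I_m -> C) (delta : C).
Hypothesis x_real : forall j, x j \is Num.real.
Hypothesis x_le1 : forall j, `|x j| <= 1.
Hypothesis delta_gt0 : 0 < delta.

Local Notation L := (node_sum x).

Hypothesis parts : forall p : {poly C}, (size p <= n.*2.+3)%N ->
  L ((1 - 'X^2) * p^`()) = L ('X * p) - delta * p`_n.*2.+1.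

(** The test function q below is conj u' times (x + 1) / (x - 1).  Up to sign, this
    factor turns the weight (1 - x^2)^(-1/2) of the sum into one that increases
    on [-1, 1], so that after integration by parts the terms in |u|^2 and |u'|^2
    have signs that force Re mu < 0; the double zero of u at 1 absorbs the pole.
    The two top coefficients of W determine the defect term. *)
Lemma energy_estimate (mu : C) (W u : {poly C}) :
    (size W <= n.+3)%N -> W`_n.+2 = 1 -> W`_n.+1 = 0 ->
    (forall j, W.[x j] = 0) -> W.[1] = 0 ->
    u - mu *: u^`() = W -> u.[1] = 0 -> mu != 0 -> 'Re mu < 0.
Proof.
move=> sW W1 W0 Wx W11 uW u1 mu0.
have u0 : u != 0.
  apply: contra_eq_neq uW => ->.
  rewrite linear0 scaler0 subr0 eq_sym; apply/negP => /eqP W00.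
  by move: W1; rewrite W00 coef0 => /eqP; rewrite eq_sym oner_eq0.
have cu i : u`_i = W`_i + mu * (u`_i.+1 *+ i.+1).
  by rewrite -uW coefB coefZ coef_deriv subrK.
have su : (size u <= n.+3)%N.
  rewrite leqNgt; apply: contraNN u0 => lt_su.
  rewrite -lead_coef_eq0 lead_coefE cu nth_default; last first.
    by apply: leq_trans sW _; rewrite -ltnS (ltn_predK lt_su).
  by rewrite nth_default ?mul0rn ?mulr0 ?addr0 ?(ltn_predK lt_su).
have u_lead : u`_n.+2 = 1.
  by rewrite cu W1 (nth_default _ su) mul0rn mulr0 addr0.
have u_next : u`_n.+1 = n.+2%:R * mu by rewrite cu W0 u_lead add0r mulrC.
have du1 : u^`().[1] = 0.
  move/(congr1 (horner^~ 1)): uW; rewrite /= hornerD hornerN hornerZ u1 W11 add0r.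
  by move/eqP; rewrite oppr_eq0 mulf_eq0 (negbTE mu0) => /eqP.
have [v uv] : exists v, u = v * ('X - 1%:P) ^+ 2.
  have /factor_theorem[h uh] : root u 1 by apply/eqP.
  have /factor_theorem[v hv] : root h 1.
    apply/eqP; move: du1; rewrite uh derivM hornerD !hornerM !hornerE subrr.
    by rewrite mulr0 add0r derivB derivX derivC subr0 hornerC mulr1.
  by exists v; rewrite uh hv expr2 mulrA.
pose g := v *+ 2 + ('X - 1%:P) * v^`().
have ug : u^`() = ('X - 1%:P) * g.
  by rewrite uv derivM deriv_exp derivXsubC /g; ring.
pose F := v * conjp v; pose p := ('X - 1%:P) ^+ 2 * F.
have conjXB : conjp ('X - 1%:P) = 'X - 1%:P :> {poly C}.
  by rewrite rmorphB /= map_polyX map_polyC /= rmorph1.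
have uup : u * conjp u = p * ('X - 1%:P) ^+ 2.
  by rewrite uv !rmorphM /= conjXB /p /F; ring.
have v0 : v != 0 by apply: contraNneq u0 => v0; rewrite uv v0 mul0r.
have sp : (size p <= n.*2.+3)%N.
  move: su; rewrite uv size_Mmonic ?monic_exp ?monicXsubC // size_exp_XsubC.
  rewrite /p /F mulrC size_Mmonic ?mulf_neq0 ?map_poly_eq0 ?monic_exp ?monicXsubC //.
  rewrite size_mul ?map_poly_eq0 // size_map_poly size_exp_XsubC.
  move: v0; rewrite -size_poly_gt0; move: (size v) => k; lia.
(* The two top coefficients of p follow from those of |u|^2 = p (x - 1)^2. *)
have p_next : p`_n.*2.+1 = 2 + n.+2%:R * (mu + mu^*).
  have su' : (size (conjp u) <= n.+3)%N by rewrite size_map_poly.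
  have pc k : (u * conjp u)`_k.+2 = p`_k - p`_k.+1 *+ 2 + p`_k.+2.
    have -> : u * conjp u = p * 'X^2 - (p * 'X) *+ 2 + p by rewrite uup; ring.
    by rewrite !coefD coefN coefMn coefMXn coefMX /= subn2.
  have p_lead : p`_n.*2.+2 = 1.
    have := @coefM_top _ u (conjp u) n.+2 n.+1 (leqW su) su'.
    have -> : (n.+2 + n.+1).+1 = n.*2.+4 by lia.
    rewrite pc !coef_map /= u_lead rmorph1 (nth_default _ su) mul0r mul1r.
    by rewrite (nth_default 0 sp) (nth_default 0 (leqW sp)) mul0rn subr0 addr0 add0r.
  have := coefM_top su su'.
  have -> : (n.+1 + n.+1).+1 = n.*2.+3 by lia.
  rewrite pc !coef_map /= u_lead u_next rmorph1 rmorphM rmorph_nat /= p_lead.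
  rewrite (nth_default 0 sp) addr0 => /eqP; rewrite subr_eq => /eqP ->.
  by rewrite mulr1 mul1r mulrDr [RHS]addrC [_ * mu + _]addrC.
pose I := L ((1 - 'X^2) * (g * conjp g)).
pose J := L ((2%:P + 'X) * p).
have I_ge0 : 0 <= I.
  apply: sumr_ge0 => j _; rewrite !hornerM (horner_conjp g (x_real j)).
  rewrite mulr_ge0 ?mul_conjC_ge0 //.
  by rewrite !hornerE subr_ge0 -real_normK // expr_le1.
have J_ge0 : 0 <= J.
  apply: sumr_ge0 => j _; rewrite /p /F (hornerM (_ + _)) (hornerM _ (v * _)) (hornerM v).
  rewrite (horner_conjp v (x_real j)).
  have /andP[xl _] : -1 <= x j <= 1 by rewrite -real_ler_norml.
  apply: mulr_ge0.
    by rewrite !hornerE -lerBlDl sub0r (le_trans _ xl) // lerN2 ler1n.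
  apply: mulr_ge0 (mul_conjC_ge0 _).
  by rewrite horner_exp real_exprn_even_ge0 ?hornerXsubC ?rpredB ?rpred1 ?x_real.
pose q := (1 + 'X) * conjp g.
have Luq : L (u * q) = - mu * I.
  have -> : u * q = W * q + mu *: (u^`() * q).
    by rewrite -uW mulrBl -scalerAl subrK.
  have LWq : L (W * q) = 0 by apply: big1 => k _; rewrite hornerM Wx mul0r.
  rewrite linearD linearZ /= LWq add0r mulNr -mulrN -linearN /=; congr (_ * L _).
  by rewrite ug /q; ring.
have key : L (u * q) + (L (u * q))^* = J + delta * p`_n.*2.+1.
  have <- : L (conjp (u * q)) = (L (u * q))^*.
    by rewrite rmorph_sum; apply: eq_bigr => j _; rewrite horner_conjp.
  rewrite -linearD.
  have cg : conjp g = conjp v *+ 2 + ('X - 1%:P) * (conjp v)^`().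
    by rewrite /g rmorphD rmorphMn rmorphM /= conjXB deriv_map.
  have cgK : conjp (conjp g) = g.
    by rewrite -map_poly_comp map_poly_id // => c _; exact: conjCK.
  have conjXD : conjp (1 + 'X) = 1 + 'X :> {poly C}.
    by rewrite rmorphD rmorph1 /= map_polyX.
  have -> : u * q + conjp (u * q) =
      - ((1 - 'X^2) * p^`()) + (2%:P * (1 + 'X)) * p.
    rewrite /q uv !rmorphM /= conjXB conjXD cgK cg /p /F /g !derivM derivXsubC.
    have -> : 2%:P = 2 :> {poly C} by rewrite polyCMn polyC1.
    rewrite polyC1 mul1r mulr1; move: (conjp v) (v^`()) => vb dv.
    exact: energy_identity.
  rewrite linearD linearN /= parts // /J opprB -addrA -linearN -linearD /=.
  by rewrite addrC; congr (L _ + _); ring.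
have bal : (mu + mu^*) * (I + delta * n.+2%:R) = - (J + delta *+ 2).
  move: key; rewrite Luq p_next rmorphM rmorphN /= (CrealP (ger0_real I_ge0)) => E.
  rewrite -[J](addrK (delta * (2 + n.+2%:R * (mu + mu^*)))) -E.
  move: (mu^*) (n.+2%:R : C) => mub c; ring.
have pos : 0 < I + delta * n.+2%:R by rewrite ltr_wpDl // mulr_gt0 // ltr0n.
have : mu + mu^* < 0.
  by rewrite -(pmulr_llt0 _ pos) bal oppr_lt0 ltr_wpDl // pmulrn_lgt0.
by rewrite ReE => neg; rewrite pmulr_llt0 // invr_gt0 ltr0n.
Qed.

(** Reflecting x changes the sign of mu in the equation, so the value at -1 is up
    to sign the value at 1 for - mu; both are values of one polynomial in mu. *)
Lemma resolvent_ends (mu : C) (W : {poly C}) :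
    size W = n.+3 -> W`_n.+2 = 1 -> W`_n.+1 = 0 -> conjp W = W ->
    W \Po (- 'X) = (-1) ^+ n *: W ->
    (forall j, W.[x j] = 0) -> W.[1] = 0 -> W^`().[1] != 0 ->
  0 < 'Re mu -> `|(resolvent mu W).[-1]| < `|(resolvent mu W).[1]|.
Proof.
move=> sW W1 W0 W_real W_par Wx W_1 dW_1 mu_gt0.
pose p := \poly_(k < (size W).-1) W^`(k.+1).[1].
have res1 nu : (resolvent nu W).[1] = nu * p.[nu].
  by rewrite horner_resolvent W_1 add0r.
have p0 : p.[0] != 0.
  by rewrite horner_coef0 coef_poly sW.
have p_roots z : root p z -> 'Re z < 0.
  move=> /eqP pz; have z0 : z != 0.
    by apply: contraNneq p0 => z0; rewrite -[X in p.[X]]z0 pz.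
  apply: (energy_estimate _ W1 W0 Wx W_1 (resolventP z W)) => //.
    by rewrite sW.
  by rewrite res1 pz mulr0.
have p_real : conjp p = p.
  apply/polyP => k; rewrite coef_map /= !coef_poly.
  case: ifP => _; last by rewrite rmorph0.
  by rewrite -horner_map /= -derivnS -derivn_map W_real rmorph1.
have p_size : (1 < size p)%N.
  rewrite ltnNge; apply/negP => sp.
  have : p`_n.+1 != 0.
    rewrite coef_poly sW ltnSn.
    rewrite (@size1_polyC _ W^`(n.+2)) ?hornerC ?coef_derivn ?addn0 ?W1.
      by rewrite pnatr_eq0 -lt0n ffact_gt0.
    apply/leq_sizeP => i i0; rewrite coef_derivn nth_default ?mul0rn // sW.
    by rewrite -addn1 leq_add2l.
  by rewrite nth_default ?eqxx // (leq_trans sp).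
have mu0 : 0 < `|mu|.
  by rewrite normr_gt0; apply: contraTneq mu_gt0 => ->; rewrite raddf0 ltxx.
have -> : `|(resolvent mu W).[-1]| = `|(resolvent (- mu) W).[1]|.
  pose V := resolvent mu W \Po (- 'X).
  have VE : V = (-1) ^+ n *: resolvent (- mu) W.
    apply/eqP; rewrite -subr_eq0; apply/eqP; apply: (@resolvent_unique _ (- mu)).
    have -> : (V - (-1) ^+ n *: resolvent (- mu) W)^`() =
        - ((resolvent mu W)^`() \Po (- 'X)) - (-1) ^+ n *: (resolvent (- mu) W)^`().
      by rewrite derivB derivZ deriv_comp derivN derivX mulrN1.
    have E : V - mu *: ((resolvent mu W)^`() \Po (- 'X)) = (-1) ^+ n *: W.
      by rewrite -W_par -[in RHS](resolventP mu W) comp_polyB comp_polyZ.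
    have {E} EV : V = (-1) ^+ n *: W + mu *: ((resolvent mu W)^`() \Po (- 'X)).
      by rewrite -E subrK.
    have EQ : resolvent (- mu) W = W - mu *: (resolvent (- mu) W)^`().
      by rewrite -{2}(resolventP (- mu) W) scaleNr opprK addrK.
    move: EV EQ; move: V (_ \Po _) (resolvent (- mu) W)^`() => V1 dV dQ -> ->.
    rewrite scaleNr -!mul_polyC; ring.
  have -> : (resolvent mu W).[-1] = V.[1] by rewrite /V horner_comp hornerN hornerX.
  by rewrite VE hornerZ normrM normrX normrN1 expr1n mul1r.
by rewrite !res1 !normrM normrN ltr_pM2l // hurwitz_reflection.
Qed.
End Energy.

(** * The node polynomial *)

Section NodePoly.
Variables (R : realType) (n : nat).
Local Notation N := n.+1.
Local Notation C := R[i].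
Local Notation extremum := (@extremum R n).

Lemma extremum0 : extremum 0 = 1.
Proof. by rewrite /extremum mul0r cos0. Qed.

Lemma extremum_norm j : `|toC (extremum j)| <= 1.
Proof. by rewrite normc_def /= expr0n addr0 sqrtr_sqr lecR cos_max. Qed.

Lemma extremum_opp j : (j <= N)%N -> extremum (N - j) = - extremum j.
Proof.
move=> jN; rewrite /extremum.
have -> : (N - j)%:R * (pi / N%:R) = - (j%:R * (pi / N%:R)) + pi :> R.
  by rewrite natrB //; field; rewrite nat1r pnatr_eq0.
by rewrite cosDpi cosN.
Qed.

Lemma extremum_reflect j : (j <= N.*2)%N -> extremum (N.*2 - j) = extremum j.
Proof.
move=> jN; rewrite /extremum.
have -> : (N.*2 - j)%:R * (pi / N%:R) = - (j%:R * (pi / N%:R)) + pi *+ 2 :> R.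
  by rewrite natrB // -muln2 natrM; field; rewrite nat1r pnatr_eq0.
by rewrite cosD2pi cosN.
Qed.

Lemma extremum_inj i j : (i <= N)%N -> (j <= N)%N -> extremum i = extremum j -> i = j.
Proof.
move=> iN jN.
have pN : 0 < pi / N%:R :> R by rewrite divr_gt0 ?pi_gt0 ?ltr0n.
have in_pi (k : nat) : (k <= N)%N -> k%:R * (pi / N%:R) \in `[0, (pi : R)].
  move=> kN; rewrite in_itv /=; apply/andP; split.
    exact: mulr_ge0 (ler0n _ _) (ltW pN).
  by rewrite mulrA ler_pdivrMr ?ltr0n // mulrC ler_pM2l ?pi_gt0 // ler_nat.
move/(cos_inj (in_pi _ iN) (in_pi _ jN)) => /(mulIf (lt0r_neq0 pN)) /eqP.
by rewrite eqr_nat => /eqP.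
Qed.

Definition node_poly : {poly C} := \prod_(i < n.+2) ('X - (toC (extremum i))%:P).

Lemma size_node_poly : size node_poly = n.+3.
Proof. by rewrite size_prod_XsubC /index_enum -enumT size_enum_ord. Qed.

Lemma node_poly_lead : node_poly`_n.+2 = 1.
Proof.
have /monicP : node_poly \is monic by rewrite monic_prod_XsubC.
by rewrite lead_coefE size_node_poly.
Qed.

Lemma extremum_rev (i : 'I_n.+2) : extremum (rev_ord i) = - extremum i.
Proof. by rewrite -extremum_opp ?subSS //; case: i. Qed.

(** The nodes are symmetric about 0, so their sum vanishes. *)
Lemma node_poly_next : node_poly`_n.+1 = 0.
Proof.
have := @coefPn_prod_XsubC _ [seq toC (extremum i) | i : 'I_n.+2 <- enum 'I_n.+2].
rewrite size_map size_enum_ord big_map big_enum /= => -> //.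
rewrite big_map big_enum /=; apply/eqP; rewrite oppr_eq0.
set S := \sum_i _.
have : S = - S.
  rewrite {1}/S (reindex_inj rev_ord_inj) -sumrN; apply: eq_bigr => i _.
  by rewrite extremum_rev rmorphN.
by move/eqP; rewrite -addr_eq0 -mulr2n mulrn_eq0.
Qed.

Lemma node_poly_real : conjp node_poly = node_poly.
Proof.
rewrite rmorph_prod; apply: eq_bigr => i _.
rewrite rmorphB /= map_polyX map_polyC; congr (_ - _%:P).
by apply/CrealP/complex_realP; exists (extremum i).
Qed.

Lemma node_poly_parity : node_poly \Po (- 'X) = (-1) ^+ n *: node_poly.
Proof.
rewrite /node_poly rmorph_prod (reindex_inj rev_ord_inj) /=.
have -> : (-1) ^+ n = \prod_(i < n.+2) (-1) :> C.
  by rewrite prodr_const card_ord !exprS mulrA mulrNN !mul1r.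
rewrite -scaler_prod; apply: eq_bigr => i _.
rewrite comp_polyB comp_polyX comp_polyC -/(rev_ord i) extremum_rev rmorphN polyCN /=.
by rewrite opprK scaleN1r opprB addrC.
Qed.

Lemma root_node_poly (i : 'I_n.+2) : node_poly.[toC (extremum i)] = 0.
Proof. by rewrite /node_poly horner_prod (bigD1 i) //= hornerXsubC subrr mul0r. Qed.

(** The angles beyond pi repeat the nodes. *)
Lemma node_poly_full j : (j < N.*2)%N -> node_poly.[toC (extremum j)] = 0.
Proof.
move=> jN; have [jn|nj] := ltnP j n.+2; first exact: (root_node_poly (Ordinal jn)).
have kn : (N.*2 - j < n.+2)%N by lia.
by rewrite -extremum_reflect 1?ltnW // (root_node_poly (Ordinal kn)).
Qed.

Lemma node_poly_1 : node_poly.[1] = 0.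
Proof. by rewrite -[1](rmorph1 (real_complex R)) -extremum0 (root_node_poly ord0). Qed.

Lemma node_poly_deriv_1 : node_poly^`().[1] != 0.
Proof.
rewrite /node_poly big_ord_recl derivM derivXsubC mul1r hornerD hornerM.
rewrite extremum0 hornerXsubC rmorph1 subrr mul0r addr0 horner_prod.
apply/prodf_neq0 => i _; rewrite hornerXsubC subr_eq0 -[1](rmorph1 (real_complex R)).
rewrite -extremum0; apply/eqP => /complexI /extremum_inj H.
by have := H (leq0n _) (ltn_ord i).
Qed.

(** Up to a scalar, Y is the resolvent of the node polynomial: Y - mu Y' has
    degree at most n + 2 and vanishes at n + 2 points. *)
Lemma collocation_ends (mu : C) (Y : {poly C}) :
    (size Y <= n.+3)%N -> Y != 0 -> 0 < 'Re mu ->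
    (forall i : 'I_n.+2, (Y - mu *: Y^`()).[toC (extremum i)] = 0) ->
  `|Y.[-1]| < `|Y.[1]|.
Proof.
move=> sY Y0 mu_gt0 Yx.
set D := Y - mu *: Y^`() in Yx.
have sD : (size D <= n.+3)%N.
  rewrite (leq_trans (size_polyD _ _)) // size_polyN geq_max sY.
  rewrite (leq_trans (size_scale_leq _ _)) //.
  exact: leq_trans (leq_trans (size_poly _ _) (leq_pred _)) sY.
have D_prop : D = D`_n.+2 *: node_poly.
  apply/eqP; rewrite -subr_eq0; apply/eqP.
  apply: (@roots_geq_poly_eq0 _ _ [seq toC (extremum i) | i : 'I_n.+2 <- enum 'I_n.+2]).
  - apply/allP => _ /mapP[i _ ->]; apply/eqP.
    by rewrite hornerD hornerN hornerZ Yx root_node_poly mulr0 subr0.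
  - rewrite map_inj_uniq ?enum_uniq // => i j /complexI /extremum_inj H.
    by apply: val_inj; apply: H; rewrite -ltnS.
  - rewrite size_map size_enum_ord; apply/leq_sizeP => k; rewrite leq_eqVlt.
    rewrite coefB coefZ => /orP[/eqP <-|lt_k].
      by rewrite node_poly_lead mulr1 subrr.
    rewrite (nth_default 0 (leq_trans sD lt_k)).
    by rewrite [node_poly`_k]nth_default ?size_node_poly // mulr0 subrr.
have YE : Y = D`_n.+2 *: resolvent mu node_poly.
  apply/eqP; rewrite -subr_eq0; apply/eqP; apply: (@resolvent_unique _ mu).
  have : D - D`_n.+2 *: (resolvent mu node_poly - mu *: (resolvent mu node_poly)^`()) = 0.
    by rewrite resolventP -D_prop subrr.
  rewrite {1}/D derivB derivZ.
  move: (D`_ _) (resolvent _ _) => c Q <-; rewrite -!mul_polyC.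
  move: (Y^`()) (Q^`()) => dY dQ; ring.
have c0 : 0 < `|D`_n.+2|.
  by rewrite normr_gt0; apply: contraNneq Y0 => c0; rewrite YE c0 scale0r.
rewrite YE !hornerZ !normrM ltr_pM2l //.
apply: (@resolvent_ends _ n N.*2 (fun j : 'I_N.*2 => toC (extremum j))
          ((N ^ 2 * 2)%:R / 4 ^+ n)) => //.
- by move=> j; apply/complex_realP; exists (extremum j).
- by move=> j; exact: extremum_norm.
- exact: extremum_sum_parts.
- exact: size_node_poly.
- exact: node_poly_lead.
- exact: node_poly_next.
- exact: node_poly_real.
- exact: node_poly_parity.
- by move=> j; exact: node_poly_full.
- exact: node_poly_1.
- exact: node_poly_deriv_1.
Qed.
End NodePoly.

(** * The stability function as a rational function *)

(** Cramer's rule gives the numerator and the denominator as polynomials in z, so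
    they may be evaluated wherever the determinant is nonzero. *)
Lemma stability_function_value (R : realType) (s : nat) (m : runge_kutta R s) (z : R[i]) :
    1%:M - z *: map_mx toC (rk_A m) \in unitmx ->
  ratfun_value (stability_function m) z
    (1 + z * ((map_mx toC (rk_b m))^T *m invmx (1%:M - z *: map_mx toC (rk_A m))
              *m (const_mx 1 : 'cV_s)) 0 0).
Proof.
set M := _ - _ => M_unit.
pose P : 'M[{poly R[i]}]_s := 1%:M - 'X *: map_mx (polyC \o toC) (rk_A m).
pose b : 'cV[{poly R[i]}]_s := map_mx (polyC \o toC) (rk_b m).
have PM : map_mx (horner_eval z) P = M.
  apply/matrixP => i j; rewrite !mxE /= /horner_eval !hornerE.
  by rewrite hornerMn hornerC.
have detP : (\det P).[z] = \det M by rewrite -PM -[LHS]/(horner_eval z _) -det_map_mx.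
have Pz0 : (\det P).[z] != 0 by rewrite detP -unitfE -unitmxE.
have P0 : tofrac (\det P) != 0.
  by rewrite tofrac_eq0; apply: contraNneq Pz0 => ->; rewrite horner0.
pose beta := (b^T *m \adj P *m (const_mx 1 : 'cV_s)) 0 0.
exists (\det P + 'X * beta), (\det P); split => //.
- rewrite /stability_function rmorphD rmorphM /= mulrDl divff //; congr (_ + _).
  rewrite -mulrA; congr (_ * _).
  have -> : 1%:M - ratfun_X R *: map_mx (@ratfun_const R) (rk_A m) = map_mx (@tofrac _) P.
    by rewrite /P map_mxB map_mx1 map_mxZ -map_mx_comp.
  have -> : map_mx (@ratfun_const R) (rk_b m) = map_mx (@tofrac _) b.
    by rewrite -map_mx_comp.
  rewrite /invmx unitmxE unitfE det_map_mx P0 -map_mx_adj.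
  rewrite -scalemxAr -scalemxAl mxE mulrC; congr (_ * _).
  rewrite /beta map_trmx.
  have -> : (const_mx 1 : 'cV[ratfun R]_s) =
      map_mx (@tofrac _) (const_mx 1 : 'cV[{poly R[i]}]_s).
    by apply/matrixP => i j; rewrite !mxE rmorph1.
  by rewrite -!map_mxM mxE.
- rewrite hornerD hornerM hornerX mulrDl divff //; congr (_ + _).
  rewrite -mulrA; congr (_ * _).
  rewrite /invmx M_unit -scalemxAr -scalemxAl mxE mulrC -detP; congr (_ / _).
  rewrite -[RHS]/(horner_eval z _) /beta.
  have -> : (const_mx 1 : 'cV[R[i]]_s) =
      map_mx (horner_eval z) (const_mx 1 : 'cV[{poly R[i]}]_s).
    by apply/matrixP => i j; rewrite !mxE rmorph1.
  have -> : map_mx toC (rk_b m) = map_mx (horner_eval z) b.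
    by apply/matrixP => i j; rewrite !mxE /= /horner_eval hornerC.
  by rewrite -PM -map_mx_adj map_trmx -!map_mxM mxE.
Qed.

(** * Collocation polynomials *)

Section Primitive.
Variable F : numFieldType.

Definition primitive (p : {poly F}) : {poly F} :=
  \poly_(i < (size p).+1) (p`_i.-1 / i%:R).

Lemma deriv_primitive p : (primitive p)^`() = p.
Proof.
apply/polyP => i; rewrite coef_deriv coef_poly ltnS.
have [ip|pi] := ltnP i (size p); last by rewrite mul0rn nth_default.
by rewrite -[LHS]mulr_natr divfK // pnatr_eq0.
Qed.

Lemma primitive_0 p : (primitive p).[0] = 0.
Proof. by rewrite horner_coef0 coef_poly invr0 mulr0. Qed.
End Primitive.

Lemma Rintegral_horner (R : realType) (p : {poly R}) (a : R) : 0 <= a ->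
  (\int[lebesgue_measure]_(t in `[0%R, a]%classic) p.[t])%R = (primitive p).[a].
Proof.
rewrite le_eqVlt => /orP[/eqP <-|a0].
  by rewrite primitive_0 set_itv1 Rintegral_set1.
rewrite /Rintegral (@continuous_FTC2 _ (horner p) (horner (primitive p))) //.
- by rewrite primitive_0 sube0.
- exact/continuous_subspaceT/continuous_horner.
- split=> [x _||].
  + exact: derivable_horner.
  + by apply: cvg_at_right_filter; exact: continuous_horner.
  + by apply: cvg_at_left_filter; exact: continuous_horner.
- by move=> x _; rewrite -derivE deriv_primitive.
Qed.

Section Collocation.
Variables (R : realType) (s : nat) (c : 'I_s -> R).
Local Notation C := R[i].
Hypothesis c_inj : injective c.
Hypothesis c_ge0 : forall i, 0 <= c i.

Definition lagrange_poly (j : 'I_s) : {poly R} :=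
  \prod_(k < s | k != j) ((c j - c k)^-1 *: ('X - (c k)%:P)).

Lemma lagrange_polyE j t : (lagrange_poly j).[t] = lagrange_basis c j t.
Proof.
rewrite horner_prod; apply: eq_bigr => k _.
by rewrite hornerZ hornerXsubC mulrC.
Qed.

Lemma lagrange_poly_node i j : (lagrange_poly j).[c i] = (i == j)%:R.
Proof.
rewrite horner_prod; have [->|ij] := eqVneq i j.
  apply: big1 => k kj; rewrite hornerZ hornerXsubC mulVf // subr_eq0.
  by apply: contra_neq kj => /c_inj.
by rewrite (bigD1 i) //= hornerZ hornerXsubC subrr mulr0 mul0r.
Qed.

Lemma size_lagrange_poly j : (size (lagrange_poly j) <= s)%N.
Proof.
have -> : lagrange_poly j = (\prod_(k < s | k != j) (c j - c k)^-1) *: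
    \prod_(k < s | k != j) ('X - (c k)%:P) by rewrite -scaler_prod.
rewrite (leq_trans (size_scale_leq _ _)) // -big_filter size_prod_XsubC size_filter.
by rewrite -sum1_count (sum1_card (predC1 j)) cardC1 card_ord (ltn_predK (ltn_ord j)).
Qed.

Lemma Rintegral_lagrange_basis j (a : R) : 0 <= a ->
  (\int[lebesgue_measure]_(t in `[0%R, a]%classic) lagrange_basis c j t)%R =
  (primitive (lagrange_poly j)).[a].
Proof.
move=> a0; rewrite -Rintegral_horner //; congr Rintegral.
by apply/funext => t; rewrite lagrange_polyE.
Qed.

(** The polynomial with value a at 0 whose derivative interpolates z y. *)
Definition collocation_poly (z a : C) (y : 'I_s -> C) : {poly C} :=
  a%:P + z *: \sum_j y j *: map_poly toC (primitive (lagrange_poly j)).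

Lemma collocation_poly_deriv z a y :
  (collocation_poly z a y)^`() = z *: \sum_j y j *: map_poly toC (lagrange_poly j).
Proof.
rewrite derivD derivC add0r derivZ raddf_sum /=; congr (_ *: _).
by apply: eq_bigr => j _; rewrite derivZ deriv_map deriv_primitive.
Qed.

Lemma collocation_poly_deriv_node z a y i :
  (collocation_poly z a y)^`().[toC (c i)] = z * y i.
Proof.
rewrite collocation_poly_deriv hornerZ horner_sum (bigD1 i) //= big1 => [|j ji].
  by rewrite addr0 hornerZ horner_map lagrange_poly_node eqxx rmorph1 mulr1.
by rewrite hornerZ horner_map lagrange_poly_node eq_sym (negbTE ji) rmorph0 mulr0.
Qed.

Lemma collocation_poly_0 z a y : (collocation_poly z a y).[0] = a.
Proof.
rewrite hornerD hornerC hornerZ horner_sum big1 ?mulr0 ?addr0 // => j _.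
by rewrite hornerZ -(rmorph0 toC) horner_map primitive_0 rmorph0 mulr0.
Qed.

Lemma collocation_poly_node z a y i :
  (collocation_poly z a y).[toC (c i)] =
  a + z * \sum_j toC (rk_A (collocation c) i j) * y j.
Proof.
rewrite hornerD hornerC hornerZ horner_sum; congr (_ + _ * _).
apply: eq_bigr => j _.
by rewrite hornerZ horner_map mxE Rintegral_lagrange_basis // mulrC.
Qed.

Lemma collocation_poly_1 z a y :
  (collocation_poly z a y).[1] = a + z * \sum_j toC (rk_b (collocation c) j 0) * y j.
Proof.
rewrite hornerD hornerC hornerZ horner_sum; congr (_ + _ * _).
apply: eq_bigr => j _.
by rewrite hornerZ -(rmorph1 toC) horner_map mxE Rintegral_lagrange_basis // mulrC.
Qed.

Lemma size_collocation_poly z a y : (size (collocation_poly z a y) <= s.+1)%N.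
Proof.
rewrite (leq_trans (size_polyD _ _)) // geq_max.
rewrite (leq_trans (size_polyC_leq1 _)) //= (leq_trans (size_scale_leq _ _)) //.
rewrite (leq_trans (size_sum _ _ _)) //; apply/bigmax_leqP => j _.
rewrite (leq_trans (size_scale_leq _ _)) // size_map_poly.
by rewrite (leq_trans (size_poly _ _)) // ltnS size_lagrange_poly.
Qed.
End Collocation.

(** * Clenshaw-Curtis collocation *)

Section ClenshawCurtis.
Variables (R : realType) (n : nat).
Local Notation C := R[i].
Local Notation node := (@clenshaw_curtis_node R n.+2).

Lemma nodeE i : node i = (1 - extremum R n i) / 2.
Proof. by rewrite /clenshaw_curtis_node /extremum /= mulrC mulrA. Qed.

Lemma node_inj : injective node.
Proof.
have h2 : 2^-1 != 0 :> R by rewrite invr_eq0 pnatr_eq0.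
move=> i j; rewrite !nodeE => /(mulIf h2)/addrI/oppr_inj/extremum_inj E.
by apply: val_inj; apply: E; rewrite -ltnS.
Qed.

Lemma node_ge0 i : 0 <= node i.
Proof. by rewrite nodeE divr_ge0 // subr_ge0 cos_le1. Qed.

(** One statement for both uses of the collocation polynomial: with a = 0 it
    contradicts the existence of a kernel vector of I - z A, and with a = 1 it
    bounds the stability function.  The last hypothesis excludes the zero
    polynomial. *)
Lemma clenshaw_curtis_contraction (z a : C) (y : 'I_n.+2 -> C) :
    complex.Re z < 0 ->
    (forall i, y i =
      a + z * \sum_j toC (rk_A (clenshaw_curtis_collocation R n.+2) i j) * y j) ->
    (a = 0 -> exists i, y i != 0) ->
  `|a + z * \sum_j toC (rk_b (clenshaw_curtis_collocation R n.+2) j 0) * y j|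
    < `|a|.
Proof.
move=> z_lt0 yE y0.
pose P := collocation_poly node z a y.
have Py i : P.[toC (node i)] = y i.
  by rewrite (collocation_poly_node node_ge0) -yE.
(* phi maps the variable x back to t; it exchanges the ends. *)
pose phi : {poly C} := (2^-1)%:P * (1 - 'X).
have phiE x : phi.[x] = (1 - x) / 2 by rewrite !hornerE mulrC.
pose Y := P \Po phi.
have Y_node (i : 'I_n.+2) : phi.[toC (extremum R n i)] = toC (node i).
  by rewrite phiE nodeE fmorph_div rmorphB rmorph1 rmorph_nat.
have z0 : z != 0 by apply: contraTneq z_lt0 => ->; rewrite ltxx.
rewrite -(collocation_poly_1 node) -{2}(collocation_poly_0 node z a y) -/P.
have -> : P.[1] = Y.[-1].
  by rewrite horner_comp phiE opprK divff ?pnatr_eq0.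
have P0 : P.[0] = Y.[1] by rewrite horner_comp phiE subrr mul0r.
rewrite P0.
apply: (@collocation_ends _ n (- 2 / z)).
- rewrite size_comp_poly2 ?size_collocation_poly //.
  by rewrite size_Cmul ?invr_eq0 ?pnatr_eq0 // -opprB size_polyN -polyC1 size_XsubC.
- apply/eqP => Y0; have [|i /eqP[]] := y0.
    by rewrite -(collocation_poly_0 node z a y) -/P P0 Y0 horner0.
  by rewrite -Py -Y_node -horner_comp -/Y Y0 horner0.
- have : 'Re z < 0 by rewrite -complexRe ltcR.
  rewrite ReMl ?rpredN ?realn // ReV mulNr oppr_gt0 pmulr_rlt0 //.
  by rewrite pmulr_llt0 // invr_gt0 exprn_gt0 // normr_gt0.
- move=> i; rewrite hornerD hornerN hornerZ /Y deriv_comp hornerM !horner_comp Y_node Py.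
  rewrite (collocation_poly_deriv_node node_inj).
  have -> : phi^`() = (- 2^-1)%:P.
    by rewrite derivM derivC mul0r add0r derivB derivX derivC sub0r mulrN1 polyCN.
  by rewrite hornerC; field.
Qed.

Lemma clenshaw_curtis_A_stable : A_stable (clenshaw_curtis_collocation R n.+2).
Proof.
move=> z z_lt0; set m := clenshaw_curtis_collocation R n.+2.
set M := 1%:M - z *: map_mx toC (rk_A m).
have mulM (v : 'cV[C]_n.+2) i :
    (M *m v) i 0 = v i 0 - z * \sum_j toC (rk_A m i j) * v j 0.
  rewrite /M mulmxBl mul1mx -scalemxAl !mxE; congr (_ - _ * _).
  by apply: eq_bigr => j _; rewrite mxE.
have M_unit : M \in unitmx.
  rewrite unitmxE unitfE -det_tr; apply/negP => /det0P[v v0 vM].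
  have Mv : M *m v^T = 0 by apply: trmx_inj; rewrite trmx_mul trmxK vM trmx0.
  have [i vi] : exists i, v^T i 0 != 0.
    by have /rV0Pn[i vi] := v0; exists i; rewrite mxE.
  suff : `|0 + z * \sum_j toC (rk_b m j 0) * v^T j 0| < `|0 : C|.
    by rewrite normr0 normr_lt0.
  apply: clenshaw_curtis_contraction => // [k|_]; last by exists i.
  by rewrite add0r; apply/eqP; rewrite -subr_eq0 -mulM Mv mxE.
exists (1 + z * ((map_mx toC (rk_b m))^T *m invmx M *m (const_mx 1 : 'cV_n.+2)) 0 0).
  exact: stability_function_value.
pose v : 'cV[C]_n.+2 := invmx M *m const_mx 1.
have Mv i : (M *m v) i 0 = 1 by rewrite mulKVmx // mxE.
have -> : ((map_mx toC (rk_b m))^T *m invmx M *m (const_mx 1 : 'cV_n.+2)) 0 0 =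
    \sum_j toC (rk_b m j 0) * v j 0.
  by rewrite -mulmxA mxE; apply: eq_bigr => j _; rewrite !mxE.
rewrite -[ltRHS]normr1; apply: clenshaw_curtis_contraction => // [i|/eqP].
  by rewrite -(Mv i) mulM subrK.
by rewrite oner_eq0.
Qed.
End ClenshawCurtis.

Theorem theorem5 (R : realType) (s : nat) (hs : (2 <= s <= 78)%N) :
  A_stable (@clenshaw_curtis_collocation R s).
Proof. by case: s hs => [|[|n]] // _; exact: clenshaw_curtis_A_stable. Qed.
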